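(* Let $\{\Phi^t\}_{t\in\mathcal{T}}$ be a dynamical system on a phase space $\Omega = \Omega_C \times \Omega_E \times \Omega_R$ partitioned into a cause component $\Omega_C$, an effect component $\Omega_E$ and a remainder component $\Omega_R$ (which may be empty). Let $\mathsf{K}_C, \mathsf{K}_E, \mathsf{K}_R$ be kernel functions on $\Omega_C, \Omega_E, \Omega_R$ respectively, such that each RKHS $\mathcal{H}(\mathsf{K}_i)$, $i \in \{C,E,R\}$, contains the constant functions; let $\mathsf{K}$ be their tensor product kernel on $\Omega$ and $\mathcal{F} = \mathcal{H}(\mathsf{K})$. Let $t > 0$, and let $\mathcal{K}^t : \mathcal{F} \to \mathcal{F}$, $\mathcal{K}^t f = f \circ \Phi^t$, be the Koopman operator. Then dynamical causal influence and Koopman causal influence at time $t$ are equivalent: $\Omega_C$ Koopman causally influences $\Omega_E$ at time $t$ if and only if $\Omega_C$ dynamically causally influences $\Omega_E$ at time $t$. Correspondingly, $\Omega_C$ does not Koopman causally influence $\Omega_E$ at time $t$ if and only if $\Omega_C$ does not dynamically causally influence $\Omega_E$ at time $t$.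
   Context: Dynamical system: the phase space $\Omega$ is $\mathbb{R}^N$ (or, more generally, an $N$-manifold), with a semigroup of flow maps $\Phi^t:\Omega\to\Omega$, $\Phi^{t+t'} = \Phi^t\circ\Phi^{t'}$, $t \in \mathcal{T}$, where $\mathcal{T}=\mathbb{N}$ or $\mathcal{T}=\mathbb{R}_{\ge 0}$ (in continuous time the flow maps are assumed differentiable). A partition $\Omega = \Omega_C\times\Omega_E\times\Omega_R$ is a splitting of the coordinates (degrees of freedom) into non-overlapping subsets; states are written $\omega = [\omega_C\;\omega_E\;\omega_R]^\top$, and $P_E$ denotes the coordinate projection onto $\Omega_E$. Dynamical causal influence: for $t>0$ put $\omega_E(t) := P_E\Phi^t([\omega_C\;\omega_E\;\omega_R]^\top)$, viewed as a function of the initial state. $\Omega_C$ dynamically causally influences $\Omega_E$ at time $t$ if $\omega_E(t)$ depends on the initial $\omega_C$, i.e. there are $\omega_C,\omega_C'\in\Omega_C$, $\omega_E\in\Omega_E$, $\omega_R\in\Omega_R$ with $P_E\Phi^t([\omega_C\;\omega_E\;\omega_R]^\top) \ne P_E\Phi^t([\omega_C'\;\omega_E\;\omega_R]^\top)$. Otherwise $\Omega_C$ does not dynamically causally influence $\Omega_E$ at time $t$. RKHS: a Hilbert space of functions to $\mathbb{C}$ on a non-empty set with all point evaluations bounded; $\mathcal{H}(\mathsf{K})$ denotes the RKHS with (positive semidefinite, complex-valued) reproducing kernel function $\mathsf{K}$. The tensor product kernel is $\mathsf{K}(\omega,\omega') = \mathsf{K}_C(\omega_C,\omega_C')\,\mathsf{K}_E(\omega_E,\omega_E')\,\mathsf{K}_R(\omega_R,\omega_R')$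 (with the factor for $R$ omitted if the remainder is empty). Component subspaces: for $X\subset\{C,E,R\}$, $\mathcal{F}_X$ is the set of $f\in\mathcal{F}$ that depend only on the components in $X$, i.e. that are constant in all components not in $X$. Thus $\mathcal{F}_E$ consists of the functions in $\mathcal{F}$ depending only on $\omega_E$, and $\mathcal{F}_{E,R}$ of the functions in $\mathcal{F}$ not depending on $\omega_C$. Koopman causal influence: $\Omega_C$ does not Koopman causally influence $\Omega_E$ at time $t$ if $\mathcal{K}^t\mathcal{F}_E \subset \mathcal{F}_{E,R}$; otherwise $\Omega_C$ Koopman causally influences $\Omega_E$ at time $t$.
   Formalization: The formal theorem additionally assumes that the RKHS of K_E separates the points of Ω_E; without this the claim fails, e.g. for all kernels equal to 1 and Φ^t(c,e) = (c, e+tc). *)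

(* Defs.v *)
From HB Require Import structures.
From mathcomp Require Import all_boot all_order all_algebra.
From mathcomp Require Import complex.
From mathcomp Require Import all_classical all_reals all_analysis.

Set Implicit Arguments.
Unset Strict Implicit.
Unset Printing Implicit Defensive.

Import Order.TTheory GRing.Theory Num.Theory.
Import numFieldNormedType.Exports.

Local Open Scope classical_set_scope.
Local Open Scope ring_scope.

(** * Differentiable manifolds *)

(* [chart_inv] inverts [chart_map] on [chart_dom] and is arbitrary outside
   the image of the chart. *)
Record chart (R : realType) (n : nat) (M : topologicalType) := Chart {
  chart_dom : set M;
  chart_map :> M -> 'rV[R]_n;
  chart_inv : 'rV[R]_n -> M;
  chart_dom_open : open chart_dom;
  chart_img_open : open (chart_map @` chart_dom);
  chart_mapK : {in chart_dom, cancel chart_map chart_inv};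
  chart_map_continuous : {in chart_dom, continuous chart_map};
  chart_inv_continuous : {in chart_map @` chart_dom, continuous chart_inv} }.

Record manifold (R : realType) (n : nat) := Manifold {
  manifold_carrier :> topologicalType;
  manifold_hausdorff : hausdorff_space manifold_carrier;
  manifold_second_countable : @second_countable manifold_carrier;
  atlas : set (chart R n manifold_carrier);
  atlas_cover : forall x, exists2 a, atlas a & chart_dom a x;
  atlas_compat : forall a b x, atlas a -> atlas b ->
    chart_dom a x -> chart_dom b x ->
    differentiable (b \o chart_inv a) (a x) }.

(* R^n with the identity chart is a manifold in the above sense. *)
Section Euclid.
Variables (R : realType) (n : nat).
Let V := 'rV[R]_n.
Let rball (qk : 'rV[rat]_n * nat) : set V :=
  ball (map_mx ratr qk.1 : V) (qk.2.+1%:R^-1 : R).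

Lemma rV_second_countable : @second_countable V.
Proof.
exists (range rball); first by apply: (sub_countable (card_image_le _ _)); exact: countableP.
split.
  move=> _ [[q k] _ <-]; exact: ball_open.
move=> x U /nbhs_ballP[e /= e0 eU].
have [k ke] : exists k : nat, k.+1%:R^-1 < e / 2 :> R.
  have e2 : 0 < e / 2 by rewrite divr_gt0.
  have /cvgrPdist_lt/(_ _ e2) [k _ /(_ k (leqnn _))] := @cvg_harmonic R.
  rewrite /= sub0r normrN gtr0_norm ?invr_gt0 ?ltr0n// => h.
  by exists k.
have k0 : 0 < k.+1%:R^-1 :> R by rewrite invr_gt0 ltr0n.
have hq j : exists q : rat, `|ratr q - x 0 j| < k.+1%:R^-1.
  have : x 0 j - k.+1%:R^-1 < x 0 j + k.+1%:R^-1 by rewrite ltrD2l gtrN.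
  by move=> /rat_in_itvoo[q]; rewrite in_itv/= -ltr_distl; exists q.
pose q : 'rV[rat]_n := \row_j projT1 (cid (hq j)).
have qx : ball (map_mx ratr q : V) (k.+1%:R^-1 : R) x.
  split=> // i j; rewrite !mxE (ord1 i) /ball/=; exact: projT2 (cid (hq j)).
exists (rball (q, k)); first by split => //; exists (q, k).
move=> y qy; apply: eU.
apply: (@le_ball _ _ _ (k.+1%:R^-1 + k.+1%:R^-1)).
  by rewrite (splitr e) lerD // ltW.
exact: (ball_triangle (ball_sym qx) qy).
Qed.
Program Definition id_chart : chart R n V := @Chart R n V setT id id _ _ _ _ _.
Next Obligation. exact: openT. Qed.
Next Obligation. by rewrite image_id; exact: openT. Qed.
Next Obligation. by []. Qed.
Next Obligation. by move=> x _; exact: cvg_id. Qed.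
Next Obligation. by move=> x _; exact: cvg_id. Qed.

Program Definition euclidean : manifold R n :=
  @Manifold R n V (@norm_hausdorff _ _) rV_second_countable [set id_chart] _ _.
Next Obligation. by exists id_chart. Qed.
Next Obligation. by move=> _ _ x -> -> _ _ /=; rewrite (_ : _ \o _ = id). Qed.
End Euclid.

(** * Dynamical systems *)

(* Both time domains are subsets of R; a flow is a family indexed by R of
   which only the members with index in the time domain matter. *)
Inductive time_kind := discrete_time | continuous_time.

Definition time_set (R : realType) (k : time_kind) : set R :=
  match k with
  | discrete_time => range (fun n : nat => n%:R)
  | continuous_time => [set t | 0 <= t]
  end.
Arguments time_set R k : clear implicits.

Section Dynamics.
Variables (R : realType) (nC nE nR : nat).
Variables (OC : manifold R nC) (OE : manifold R nE) (OR : manifold R nR).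

Definition phase : topologicalType := (OC * OE * OR)%type.

(* A self-map of the product manifold is read in products of charts. *)
Definition differentiable_map (F : phase -> phase) : Prop :=
  continuous F /\
  forall (aC bC : chart R nC OC) (aE bE : chart R nE OE) (aR bR : chart R nR OR)
    (w : phase),
  atlas aC -> atlas bC -> atlas aE -> atlas bE -> atlas aR -> atlas bR ->
  chart_dom aC w.1.1 -> chart_dom aE w.1.2 -> chart_dom aR w.2 ->
  chart_dom bC (F w).1.1 -> chart_dom bE (F w).1.2 -> chart_dom bR (F w).2 ->
  differentiable
    (fun u : 'rV[R]_nC * 'rV[R]_nE * 'rV[R]_nR =>
       let w' := F (chart_inv aC u.1.1, chart_inv aE u.1.2, chart_inv aR u.2) in
       (bC w'.1.1, bE w'.1.2, bR w'.2))
    (aC w.1.1, aE w.1.2, aR w.2).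

Definition dynamical_system (k : time_kind) (Phi : R -> phase -> phase) : Prop :=
  (forall t t', time_set R k t -> time_set R k t' ->
     Phi (t + t') = Phi t \o Phi t') /\
  (k = continuous_time ->
     forall t, time_set R k t -> differentiable_map (Phi t)).

Definition proj_effect (w : phase) : OE := w.1.2.

Definition dyn_influences (Phit : phase -> phase) : Prop :=
  exists (c c' : OC) (e : OE) (r : OR),
    proj_effect (Phit (c, e, r)) <> proj_effect (Phit (c', e, r)).

Definition not_dyn_influences (Phit : phase -> phase) : Prop :=
  ~ dyn_influences Phit.

End Dynamics.

(** * Reproducing kernel Hilbert spaces *)

(* A complex Hilbert space [rkhs_space] realized, through the injective linear
   map [rkhs_fun], as a space of functions on a non-empty set. The form is
   linear in its first argument. *)
Record rkhs (R : realType) (X : Type) := Rkhs {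
  rkhs_space :> completeNormedModType R[i];
  rkhs_dot : {dot rkhs_space for Num.conj};
  rkhs_dotE : forall f : rkhs_space, rkhs_dot f f = `|f| ^+ 2;
  rkhs_fun : {linear rkhs_space -> (X -> R[i])};
  rkhs_fun_inj : injective rkhs_fun;
  rkhs_eval_bounded : forall x, exists M : R[i],
    forall f : rkhs_space, `|rkhs_fun f x| <= M * `|f|;
  rkhs_nonempty : inhabited X }.
Arguments rkhs_dot {R X} r.
Arguments rkhs_fun {R X r}.

Section Kernels.
Variable R : realType.

Definition psd_kernel (X : Type) (K : X -> X -> R[i]) : Prop :=
  forall (n : nat) (x : 'I_n -> X) (a : 'I_n -> R[i]),
    0 <= \sum_(i < n) \sum_(j < n) (a i)^* * a j * K (x i) (x j).

(* [H] is the space H(K): the sections K(., x) belong to [H] and reproduce. *)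
Definition reproducing_kernel (X : Type) (H : rkhs R X) (K : X -> X -> R[i]) :
    Prop :=
  forall x, exists2 k : H, rkhs_fun k = (fun y => K y x) &
    forall f : H, rkhs_fun f x = rkhs_dot H f k.

Definition contains_constants (X : Type) (H : rkhs R X) : Prop :=
  forall a : R[i], exists f : H, rkhs_fun f = (fun=> a).

(* The reproducing kernel of a space need not separate points: for K = 1 the
   space H(K) consists of the constants and sees no difference between states. *)
Definition separates_points (X : Type) (H : rkhs R X) : Prop :=
  forall x y : X, x <> y -> exists f : H, rkhs_fun f x <> rkhs_fun f y.

Definition tensor_kernel (XC XE XR : Type) (KC : XC -> XC -> R[i])
    (KE : XE -> XE -> R[i]) (KR : XR -> XR -> R[i]) :
    XC * XE * XR -> XC * XE * XR -> R[i] :=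
  fun w w' => KC w.1.1 w'.1.1 * KE w.1.2 w'.1.2 * KR w.2 w'.2.

End Kernels.

(** * Component subspaces and Koopman causal influence *)

Inductive component := cause | effect | remainder.

Section Koopman.
Variables (R : realType) (XC XE XR : Type).
Variable F : rkhs R (XC * XE * XR).

Definition same_component (i : component) (w w' : XC * XE * XR) : Prop :=
  match i with
  | cause => w.1.1 = w'.1.1
  | effect => w.1.2 = w'.1.2
  | remainder => w.2 = w'.2
  end.

Definition component_subspace (X : set component) : set F :=
  [set f | forall w w', (forall i, X i -> same_component i w w') ->
                        rkhs_fun f w = rkhs_fun f w'].

Definition koopman_operator (Phit : XC * XE * XR -> XC * XE * XR)
    (Kt : F -> F) : Prop :=
  forall f : F, rkhs_fun (Kt f) = rkhs_fun f \o Phit.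

Definition not_koopman_influences (Kt : F -> F) : Prop :=
  Kt @` component_subspace [set effect]
    `<=` component_subspace [set effect; remainder].

Definition koopman_influences (Kt : F -> F) : Prop :=
  ~ not_koopman_influences Kt.

End Koopman.

(* Main.v *)
Require Import Defs.
From mathcomp Require Import all_boot all_order all_algebra.
From mathcomp Require Import complex.
From mathcomp Require Import all_classical all_reals all_analysis.

Set Implicit Arguments.
Unset Strict Implicit.
Unset Printing Implicit Defensive.

Import Order.TTheory GRing.Theory Num.Theory.
Import numFieldNormedType.Exports.

Local Open Scope classical_set_scope.
Local Open Scope ring_scope.

(** Only one implication has content. If the effect at time t ignores the
    cause, then composing a function of the effect alone with the flow gives a
    function that ignores the cause. Conversely, suppose that a change of the
    cause moves the effect from e to e'. Since H(KE) separates points and its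
    sections reproduce values, some section KE(., e0) takes different values at
    e and e' ([separating_section]). If (c, e, r) |-> KE(e, e0) belongs to the
    space F of the tensor product kernel, then it is a function of the effect
    alone whose Koopman image depends on the cause.

    So the proof rests on showing that F contains u (x) KE(., e0) (x) v for all
    u in H(KC) and v in H(KR) ([tensor_with_section]), and in particular for the
    constants u = v = 1 ([effect_function]). What is given is that F contains
    the sections of the product kernel, that is, the case where u and v are
    themselves sections. They are replaced by arbitrary elements one factor at a
    time: with the other factors held fixed, sending the section k_c of KC to
    the section k_(c, e0, r) multiplies all inner products by a constant, so it
    extends to a multiple of an isometry from H(KC) to F
    ([isometric_extension]); the image of u is u (x) KE(., e0) (x) KR(., r). The
    same argument in the variable r then replaces KR(., r) by v.

    The extension needs the span of the sections to be dense ([total_dense]).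
    This is obtained from elements of the span that almost minimize the distance
    to a given g: the difference to g is then almost orthogonal to the span, any
    two of them are close to each other, and their limit differs from g by a
    vector orthogonal to all sections, that is, by 0. *)

(** * Finite linear combinations *)

Section Combination.
Variables (C : pzRingType) (X : Type).
Implicit Types (V : lmodType C) (s : seq (C * X)) (a : C).

(** Indexing combinations by their coefficients, not by their values, lets
    the same coefficients be used with two families of vectors, without having
    to check that a map defined on the span is well defined. *)
Definition combination V (v : X -> V) s : V := \sum_(p <- s) p.1 *: v p.2.

Definition scale_coefs a s := [seq (a * p.1, p.2) | p <- s].

Lemma combination_cat V (v : X -> V) s1 s2 :
  combination v (s1 ++ s2) = combination v s1 + combination v s2.
Proof. exact: big_cat. Qed.

Lemma combination_scale V (v : X -> V) a s :
  combination v (scale_coefs a s) = a *: combination v s.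
Proof.
rewrite /combination big_map scaler_sumr.
by apply: eq_bigr => p _; rewrite scalerA.
Qed.

Lemma combination_diff V (v : X -> V) s1 s2 :
  combination v (s1 ++ scale_coefs (-1) s2) =
  combination v s1 - combination v s2.
Proof. by rewrite combination_cat combination_scale scaleN1r. Qed.

Lemma combination1 V (v : X -> V) x : combination v [:: (1, x)] = v x.
Proof. by rewrite /combination big_seq1 scale1r. Qed.
End Combination.

(** * Limits of approximations *)

Lemma pos_lower_bound (C : numDomainType) (a b : C) :
  0 < a -> 0 < b -> exists c, [/\ 0 < c, c <= a & c <= b].
Proof.
move=> a0 b0; have [ab|/ltW ba] := real_leP (gtr0_real a0) (gtr0_real b0).
  by exists a.
by exists b.
Qed.

Lemma eq0_le_mul_pos (C : numFieldType) (a M : C) : 0 <= a -> 0 <= M ->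
  (forall e, 0 < e -> a <= M * e) -> a = 0.
Proof.
move=> a0 M0 aM; apply/eqP; apply: contraT => an.
have {an}a0 : 0 < a by rewrite lt_def an.
have M1 : 0 < M + 1 by rewrite ltr_wpDl.
have /aM : 0 < a / (M + 1) by rewrite divr_gt0.
rewrite mulrCA ler_pMr// ler_pdivlMr// mul1r => h.
by move: h; rewrite gerDl ler10.
Qed.

(** Completeness for approximations indexed by their error: the sets [A e]
    form the base of a Cauchy filter, so no sequence has to be chosen. *)
Lemma approx_limit (C : numFieldType) (V : completeNormedModType C)
    (A : C -> set V) (D : C) : 0 <= D ->
  (forall e, 0 < e -> A e !=set0) ->
  (forall e e', e <= e' -> A e `<=` A e') ->
  (forall e v v', 0 < e -> A e v -> A e v' -> `|v - v'| <= D * e) ->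
  exists l, forall e, 0 < e -> exists2 v, A e v & `|l - v| <= e.
Proof.
move=> D0 A0 Amono Adiam.
pose G := filter_from [set e : C | 0 < e] A.
have GF : ProperFilter G.
  apply: filter_from_proper; last by move=> e; exact: A0.
  apply: filter_from_filter; first by exists 1 => /=; exact: ltr01.
  move=> e e' /= e0 e'0; have [c [c0 ce ce']] := pos_lower_bound e0 e'0.
  by exists c => // v Av; split; apply: Amono Av.
have D1 : 0 < D + 1 by rewrite ltr_wpDl.
have Gcvg : cvg G.
  apply/cauchy_cvgP/cauchy_exP => e e0.
  have d0 : 0 < e / (D + 1) by rewrite divr_gt0.
  have [v Av] := A0 _ d0; exists v; exists (e / (D + 1)) => // u Au.
  rewrite -ball_normE /ball_/=; apply: le_lt_trans (Adiam _ _ _ d0 Av Au) _.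
  by rewrite mulrCA gtr_pMr// ltr_pdivrMr// mul1r ltrDl ltr01.
exists (lim G) => e e0.
have [d /= d0 dA] : G (ball (lim G) e).
  by apply: Gcvg; exact: nbhsx_ballx.
have [c [c0 cd ce]] := pos_lower_bound d0 e0; have [v Av] := A0 _ c0.
exists v; first exact: Amono Av.
by have := dA v (Amono _ _ cd _ Av); rewrite -ball_normE /ball_/= => /ltW.
Qed.

(** * Projections and density in Hilbert spaces *)

Section Hilbert.
Variables (R : realType) (V : completeNormedModType R[i]).
Variable dot : {dot V for Num.conj}.
Hypothesis dotE : forall v, dot v v = `|v| ^+ 2.
Local Notation C := R[i].

Lemma dotC u v : dot u v = (dot v u)^*.
Proof. by rewrite hermC mul1r. Qed.

(** The best choice a = <w, u> / |u|^2 lowers |w|^2 by |<w, u>|^2 / |u|^2, which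
    the hypothesis bounds by d. For d = |w|^2 the hypothesis is trivial and the
    conclusion is the Cauchy-Schwarz inequality. *)
Lemma almost_minimal_dot (d : C) w u : 0 <= d ->
  (forall a, `|w| ^+ 2 <= `|w - a *: u| ^+ 2 + d) ->
  `|dot w u| ^+ 2 <= d * `|u| ^+ 2.
Proof.
move=> d0 wmin; have [->|u0] := eqVneq u 0.
  by rewrite linear0r !normr0 expr0n/= mulr0.
have u2 : 0 < `|u| ^+ 2 by rewrite exprn_gt0// normr_gt0.
set q := `|u| ^+ 2 in u2 *; set z := dot w u.
have qr : q^* = q by rewrite conj_Creal// gtr0_real.
pose m := `|z| ^+ 2 / q.
have mr : m^* = m by rewrite conj_Creal// ger0_real// divr_ge0 ?exprn_ge0// ltW.
have dz : dot w ((z / q) *: u) = m.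
  by rewrite linearZr_LR/= rmorphM/= fmorphV/= qr mulrAC [_^* * _]mulrC -normCK.
have qz : `|z / q| ^+ 2 * q = m.
  rewrite normrM normfV [`|q|]gtr0_norm// exprMn -mulrA; congr (_ * _).
  by rewrite expr2 mulfVK// gt_eqF.
have := wmin (z / q); rewrite -(dotE (w - _)) dnormB dnormZ !dotE -/q dz qz mr.
rewrite opprD addrA addrK -addrA lerDl addrC subr_ge0.
by rewrite ler_pdivrMr.
Qed.

Lemma dot_CauchySchwarz u v : `|dot u v| <= `|u| * `|v|.
Proof.
rewrite -ler_sqr ?nnegrE ?mulr_ge0// exprMn.
apply: almost_minimal_dot; rewrite ?exprn_ge0// => a.
by rewrite lerDr exprn_ge0.
Qed.

Section Total.
Variables (X : Type) (k : X -> V).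
Local Notation comb := (combination k).

(** Take a combination whose squared distance to [g] exceeds the infimum by less
    than e^2, and apply [almost_minimal_dot] with d = e^2. *)
Lemma almost_projection g e : 0 < e ->
  exists s, forall s', `|dot (g - comb s) (comb s')| <= e * `|comb s'|.
Proof.
(* The infimum exists in R, while the norm has values in R[i]. *)
move=> e0; pose sqdist s : R := complex.Re (`|g - comb s| ^+ 2).
have ReK (z : C) : 0 <= z -> z = (complex.Re z)%:C%C.
  by case: z => a b; rewrite lecE/= => /andP[/eqP->].
have sqdistE s : `|g - comb s| ^+ 2 = (sqdist s)%:C%C.
  by apply: ReK; rewrite exprn_ge0.
have e2 : e ^+ 2 = (complex.Re (e ^+ 2))%:C%C.
  by apply: ReK; rewrite exprn_ge0// ltW.
have lbE : lbound (range sqdist) 0.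
  by move=> _ [s _ <-]; rewrite -lecR -sqdistE exprn_ge0.
have infE : has_inf (range sqdist).
  by split; [exists (sqdist [::]), [::]|exists 0].
have [|_ [s _ <-] smin] := @inf_adherent _ _ (complex.Re (e ^+ 2)) _ infE.
  by rewrite -ltcR -e2 exprn_gt0.
exists s => s'; rewrite -ler_sqr ?nnegrE ?mulr_ge0 ?(ltW e0)// exprMn.
apply: almost_minimal_dot => [|a]; first by rewrite exprn_ge0// ltW.
rewrite -combination_scale -addrA -opprD -combination_cat !sqdistE e2.
rewrite -rmorphD/= lecR; apply: le_trans (ltW smin) _; rewrite lerD2r.
by apply: ge_inf; [case: infE|exists (s ++ scale_coefs a s')].
Qed.

Hypothesis total : forall v, (forall x, dot v (k x) = 0) -> v = 0.

(** Almost projections of [g] onto the span converge, by completeness, to some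
    [l] such that g - l is orthogonal to every [k x]. *)
Lemma total_dense g e : 0 < e -> exists s, `|g - comb s| <= e.
Proof.
pose A (d : C) : set V := [set v | exists2 s, v = comb s &
  forall s', `|dot (g - comb s) (comb s')| <= d * `|comb s'|].
have [|d d0|d d' dd' v [s -> sP]|d _ _ d0 [s -> sP] [s' -> s'P]|l lP] :=
    @approx_limit _ V A 2.
- exact: ler0n.
- by have [s sP] := almost_projection g d0; exists (comb s); exists s.
- by exists s => // s'; apply: le_trans (sP s') _; rewrite ler_wpM2r.
- (* The difference lies in the span, and both errors are almost orthogonal
     to it: |v - v'|^2 = <g - v', v - v'> - <g - v, v - v'> <= 2 d |v - v'|. *)
  rewrite -combination_diff; set s2 := (X in comb X).
  have [->|n0] := eqVneq (comb s2) 0.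
    by rewrite normr0 mulr_ge0 ?ler0n// ltW.
  have n1 : 0 < `|comb s2| by rewrite normr_gt0.
  have s2E : comb s2 = (g - comb s') - (g - comb s).
    by rewrite combination_diff opprB [RHS]addrC addrA subrK.
  have : dot (comb s2) (comb s2) =
      dot (g - comb s') (comb s2) - dot (g - comb s) (comb s2).
    by rewrite {1}s2E linearBl.
  move=> /(congr1 (fun z => `|z|)); rewrite dotE normrX normr_id => s2n.
  rewrite -(ler_pM2r n1) -expr2 s2n (le_trans (ler_normB _ _))//.
  by rewrite mulr_natl mulrnAl mulr2n lerD.
suff -> : g = l by move=> e0; have [v [s -> _] ?] := lP e e0; exists s.
apply/eqP; rewrite -subr_eq0; apply/eqP/total => x.
apply/eqP; rewrite -normr_eq0; apply/eqP.
apply: (@eq0_le_mul_pos _ _ (2 * `|k x|)) => // d d0.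
have [_ [s -> sP] sl] := lP d d0.
have -> : g - l = (g - comb s) - (l - comb s) by rewrite opprB addrA subrK.
rewrite linearBl/=; apply: le_trans (ler_normB _ _) _.
rewrite mulrC mulrA mulr_natr mulr2n mulrDl lerD//.
  by have := sP [:: (1, x)]; rewrite combination1.
by apply: le_trans (dot_CauchySchwarz _ _) _; rewrite ler_wpM2r.
Qed.
End Total.
End Hilbert.

(** * Extension of isometries *)

Section IsometricExtension.
Variables (R : realType) (V W : completeNormedModType R[i]).
Variables (dotV : {dot V for Num.conj}) (dotW : {dot W for Num.conj}).
Hypothesis dotVE : forall v, dotV v v = `|v| ^+ 2.
Hypothesis dotWE : forall w, dotW w w = `|w| ^+ 2.
Variables (X : Type) (k : X -> V) (phi : X -> W) (c : R[i]).
Hypothesis c_ge0 : 0 <= c.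
Hypothesis phi_isometry :
  forall x y, dotW (phi x) (phi y) = c ^+ 2 * dotV (k x) (k y).

Lemma combination_isometry s :
  `|combination phi s| = c * `|combination k s|.
Proof.
apply/eqP; rewrite -(@eqrXn2 _ 2)// ?mulr_ge0// exprMn -dotWE -dotVE.
apply/eqP; rewrite /combination !linear_sumlz mulr_sumr.
apply: eq_bigr => p _ /=.
rewrite !linear_sumr; apply: eq_bigr => p' _ /=.
rewrite linearZlr [dotV _ _]linearZlr/= phi_isometry.
by rewrite [p'.1^* * _]mulrCA [LHS]mulrCA.
Qed.

Hypothesis total : forall v, (forall x, dotV v (k x) = 0) -> v = 0.

(** The image [h] of [g] is the limit of the combinations of the [phi x] whose
    coefficients approximate [g] in the family [k]. It is described through the
    adjoint: if [v] is the image of [w] under the adjoint, which can be tested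
    on the [k x], then <w, h> = <v, g>. This gives both the values of [h], when
    [w] is a section of a kernel, and the inner products of such images. *)
Lemma isometric_extension g : exists h, forall w v,
  (forall x, dotW w (phi x) = dotV v (k x)) -> dotW w h = dotV v g.
Proof.
pose A (d : R[i]) : set W :=
  [set w | exists2 s, w = combination phi s & `|g - combination k s| <= d].
have [|d d0|d d' dd' v [s -> sd]|d _ _ d0 [s -> sd] [s' -> s'd]|h hP] :=
    @approx_limit _ W A (2 * c).
- by rewrite mulr_ge0.
- have [s sd] := total_dense dotVE total g d0.
  by exists (combination phi s); exists s.
- by exists s => //; exact: le_trans dd'.
- rewrite -combination_diff combination_isometry combination_diff.
  rewrite [2 * c]mulrC -mulrA ler_wpM2l// mulr_natl mulr2n.
  rewrite -[combination k s](subrK g) -addrA (le_trans (ler_normD _ _))//.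
  by rewrite lerD// distrC.
exists h => w v wv; apply/eqP; rewrite -subr_eq0 -normr_eq0; apply/eqP.
apply: (@eq0_le_mul_pos _ _ (`|w| + `|v|)) => // d d0.
have [_ [s -> sg] sh] := hP d d0.
have wvs : dotW w (combination phi s) = dotV v (combination k s).
  rewrite /combination !linear_sumr; apply: eq_bigr => p _ /=.
  by rewrite !linearZr_LR/= wv.
have -> : dotW w h - dotV v g =
    dotW w (h - combination phi s) - dotV v (g - combination k s).
  by rewrite !linearBr/= wvs opprB addrA subrK.
apply: le_trans (ler_normB _ _) _; rewrite mulrDl lerD//.
  by apply: le_trans (dot_CauchySchwarz dotWE _ _) _; rewrite ler_wpM2l.
by apply: le_trans (dot_CauchySchwarz dotVE _ _) _; rewrite ler_wpM2l.
Qed.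
End IsometricExtension.

(** * Functions in a tensor product kernel space *)

Section TensorProduct.
Variable R : realType.

Lemma rkhs_dotC (X : Type) (H : rkhs R X) (f g : H) :
  rkhs_dot H f g = (rkhs_dot H g f)^*.
Proof. exact: dotC. Qed.

Lemma rkhs_funZ (X : Type) (H : rkhs R X) a (f : H) x :
  rkhs_fun (a *: f) x = a * rkhs_fun f x.
Proof. by rewrite linearZ. Qed.

Lemma kernel_sections (X : Type) (H : rkhs R X) K : reproducing_kernel H K ->
  exists k : X -> H, (forall x y, rkhs_fun (k x) y = K y x) /\
    (forall f x, rkhs_dot H f (k x) = rkhs_fun f x).
Proof.
move=> HK; pose k x := projT1 (cid2 (HK x)); exists k; split=> [x y|f x];
  by rewrite /k; case: cid2 => g /= gE gK; rewrite ?gE ?gK.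
Qed.

Lemma kernel_conj (X : Type) (H : rkhs R X) K : reproducing_kernel H K ->
  forall x y, K x y = (K y x)^*.
Proof.
move=> /kernel_sections[k [kE kK]] x y.
by rewrite -kE -kK rkhs_dotC kK kE.
Qed.

Lemma sections_total (X : Type) (H : rkhs R X) (f : H) :
  (forall x, rkhs_fun f x = 0) -> f = 0.
Proof.
move=> f0; apply: (@rkhs_fun_inj _ _ H); apply/funext => x.
by rewrite linear0 f0.
Qed.

Variables (XC XE XR : Type).
Variables (HC : rkhs R XC) (HE : rkhs R XE) (HR : rkhs R XR).
Variables (KC : XC -> XC -> R[i]) (KE : XE -> XE -> R[i]).
Variable KR : XR -> XR -> R[i].
Variable F : rkhs R (XC * XE * XR).
Hypotheses (hHC : reproducing_kernel HC KC) (hHE : reproducing_kernel HE KE).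
Hypotheses (hHR : reproducing_kernel HR KR).
Hypothesis hF : reproducing_kernel F (tensor_kernel KC KE KR).

(** The factors [u] and [v] are inserted one after the other, each time
    extending a scaled isometry from the sections of one factor. *)
Lemma tensor_with_section (u : HC) (v : HR) e0 : exists h : F,
  forall w, rkhs_fun h w = rkhs_fun u w.1.1 * KE w.1.2 e0 * rkhs_fun v w.2.
Proof.
have [kC [kCE kCK]] := kernel_sections hHC.
have [kE [kEE kEK]] := kernel_sections hHE.
have [kR [kRE kRK]] := kernel_sections hHR.
have [kF [kFE kFK]] := kernel_sections hF.
have KEE : KE e0 e0 = `|kE e0| ^+ 2 by rewrite -rkhs_dotE kEK kEE.
(* [h1 r] is u (x) KE(., e0) (x) KR(., r), the image of [u] when k_c is sent to
   k_(c, e0, r); its values are computed in [h1E]. *)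
have /choice[h1 h1P] : forall r, exists h : F, forall (f : F) (f0 : HC),
    (forall c, rkhs_fun f (c, e0, r) = rkhs_fun f0 c) ->
    rkhs_dot F f h = rkhs_dot HC f0 u.
  move=> r; have KRR : KR r r = `|kR r| ^+ 2 by rewrite -rkhs_dotE kRK kRE.
  have [||g g0|h hP] := @isometric_extension R HC F (rkhs_dot HC) (rkhs_dot F)
    (@rkhs_dotE _ _ HC) (@rkhs_dotE _ _ F) XC kC (fun c => kF (c, e0, r))
    (`|kE e0| * `|kR r|) _ _ _ u.
  - by rewrite mulr_ge0.
  - move=> c c'; rewrite kFK kCK kFE kCE /tensor_kernel/= KEE KRR exprMn.
    by rewrite -mulrA mulrC.
  - by apply: sections_total => c; rewrite -kCK.
  exists h => f f0 ff0; apply: hP => c; by rewrite kFK kCK.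
have h1E r w : rkhs_fun (h1 r) w = rkhs_fun u w.1.1 * KE w.1.2 e0 * KR w.2 r.
  rewrite -kFK rkhs_dotC (h1P _ _ ((KE e0 w.1.2 * KR r w.2) *: kC w.1.1)).
    rewrite linearZl_LR/= rmorphM/= -rkhs_dotC kCK rmorphM/=.
    by rewrite -(kernel_conj hHE) -(kernel_conj hHR) mulrC mulrA.
  move=> c; rewrite kFE rkhs_funZ kCE /tensor_kernel/=.
  by rewrite -mulrA mulrC.
(* Sending k_r to [h1 r] scales inner products by |KE(., e0)|^2 |u|^2. *)
have [||g g0|h hP] := @isometric_extension R HR F (rkhs_dot HR) (rkhs_dot F)
  (@rkhs_dotE _ _ HR) (@rkhs_dotE _ _ F) XR kR h1 (`|kE e0| * `|u|) _ _ _ v.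
- by rewrite mulr_ge0.
- move=> r r'; rewrite kRK kRE (h1P _ _ ((KE e0 e0 * KR r' r) *: u)).
    by rewrite linearZl_LR/= rkhs_dotE KEE exprMn mulrAC.
  move=> c; rewrite h1E rkhs_funZ/=.
  by rewrite -mulrA mulrC.
- by apply: sections_total => r; rewrite -kRK.
exists h => w; rewrite -kFK rkhs_dotC.
rewrite (hP _ ((rkhs_fun u w.1.1 * KE w.1.2 e0)^* *: kR w.2)).
  by rewrite linearZl_LR/= rmorphM/= conjCK -rkhs_dotC kRK.
move=> r; rewrite rkhs_dotC kFK h1E kRK rkhs_funZ kRE.
by rewrite rmorphM/= -(kernel_conj hHR).
Qed.
End TensorProduct.

(** * Functions of the effect *)

Section EffectFunctions.
Variables (R : realType) (XC XE XR : Type).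
Variables (HC : rkhs R XC) (HE : rkhs R XE) (HR : rkhs R XR).
Variables (KC : XC -> XC -> R[i]) (KE : XE -> XE -> R[i]).
Variable KR : XR -> XR -> R[i].
Variable F : rkhs R (XC * XE * XR).
Hypotheses (hHC : reproducing_kernel HC KC) (hHE : reproducing_kernel HE KE).
Hypotheses (hHR : reproducing_kernel HR KR).
Hypothesis hF : reproducing_kernel F (tensor_kernel KC KE KR).

(** If all sections agree at [e] and [e'], then by Hermitian symmetry the
    sections based at [e] and [e'] are equal, and they reproduce the values of
    every function there. *)
Lemma separating_section (e e' : XE) : separates_points HE -> e <> e' ->
  exists e0, KE e e0 <> KE e' e0.
Proof.
move=> sE /sE[f fee']; apply: contrapT => /forallNP KEee'.
have [k [kfun kK]] := kernel_sections hHE.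
apply: fee'; rewrite -!kK; congr (rkhs_dot _ _ _).
apply: (@rkhs_fun_inj _ _ HE); apply/funext => x.
by rewrite !kfun (kernel_conj hHE) (contrapT (KEee' x)) -(kernel_conj hHE).
Qed.

Lemma effect_function (e0 : XE) :
  contains_constants HC -> contains_constants HR ->
  exists2 h : F, component_subspace [set effect] h &
    forall w, rkhs_fun h w = KE w.1.2 e0.
Proof.
move=> /(_ 1)[u uE] /(_ 1)[v vE].
have [h hE] := tensor_with_section hHC hHE hHR hF u v e0.
have hE' w : rkhs_fun h w = KE w.1.2 e0 by rewrite hE uE vE mul1r mulr1.
by exists h => // w w' /(_ effect erefl)/= ww'; rewrite !hE' ww'.
Qed.

End EffectFunctions.

(** * Equivalence of the two notions of causal influence *)

Theorem mainTheorem2 (R : realType) (nC nE nR : nat)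
  (OC : manifold R nC) (OE : manifold R nE) (OR : manifold R nR)
  (k : time_kind) (Phi : R -> phase OC OE OR -> phase OC OE OR)
  (hPhi : dynamical_system k Phi)
  (KC : OC -> OC -> R[i]) (KE : OE -> OE -> R[i]) (KR : OR -> OR -> R[i])
  (hKC : psd_kernel KC) (hKE : psd_kernel KE) (hKR : psd_kernel KR)
  (HC : rkhs R OC) (HE : rkhs R OE) (HR : rkhs R OR)
  (hHC : reproducing_kernel HC KC) (hHE : reproducing_kernel HE KE)
  (hHR : reproducing_kernel HR KR)
  (cC : contains_constants HC) (cE : contains_constants HE)
  (cR : contains_constants HR)
  (sE : separates_points HE)
  (F : rkhs R (OC * OE * OR))
  (hF : reproducing_kernel F (tensor_kernel KC KE KR))
  (t : R) (ht : time_set R k t) (t_gt0 : 0 < t)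
  (Kt : F -> F) (hKt : koopman_operator (Phi t) Kt) :
  (koopman_influences Kt <-> dyn_influences (Phi t)) /\
  (not_koopman_influences Kt <-> not_dyn_influences (Phi t)).
Proof.
suff noinf : not_koopman_influences Kt <-> not_dyn_influences (Phi t).
  split=> //; rewrite /koopman_influences noinf /not_dyn_influences.
  by split; [exact: contrapT|move=> ? /(_ _)].
split.
  move=> KtE [c [c' [e [r]]]] /(separating_section hHE sE)[e0]; apply.
  have [h hE hfun] := effect_function hHC hHE hHR hF e0 cC cR.
  have /(_ (c, e, r) (c', e, r)) := KtE _ (ex_intro2 _ _ h hE erefl).
  rewrite !hKt /= !hfun; apply.
  by case=> // -[].
move=> ninf _ [f fE <-] [[c e] r] [[c' e'] r'] ww'.
have /= ee' := ww' effect (or_introl erefl).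
have /= rr' := ww' remainder (or_intror erefl).
rewrite !hKt /= -{}ee' -{}rr'; apply: fE => _ ->.
by apply: contrapT => n; apply: ninf; exists c, c', e, r.
Qed.
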